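(* Let $A$ be an $M$-approximately unital Banach algebra. Any $x\in A$ with $\|x\|<1$ may be written as $x=a-b$ with $a,b\in{\mathfrak r}_A$, $\|a\|<1$ and $\|b\|<1$. In fact one may choose such $a,b$ to also lie in $\frac12{\mathfrak F}_A$.
   Context: Banach algebras are complex with submultiplicative norm; ''unital'' means identity of norm 1. $A$ is approximately unital if it has a contractive approximate identity. Its multiplier unitization $A^1$ is $A$ if $A$ is unital, otherwise $A+\mathbb{C}1$ with $\|a+\lambda1\|=\sup\{\|ac+\lambda c\|:c\in A,\|c\|\le1\}$. ${\mathfrak F}_A=\{a\in A:\|1-a\|_{A^1}\le1\}$, so $\frac12{\mathfrak F}_A=\{a\in A:\|1-2a\|_{A^1}\le1\}$. ${\mathfrak r}_A=\{a\in A:\mathrm{Re}\,\varphi(a)\ge0$ for all $\varphi\in(A^1)^*$ with $\|\varphi\|=\varphi(1)=1\}$. A subspace $E$ of a Banach space $X$ is an $M$-ideal if there is a projection $P$ of $X^{**}$ onto $E^{\perp\perp}$ with $\|\eta\|=\max\{\|P\eta\|,\|\eta-P\eta\|\}$ for all $\eta\in X^{**}$. $A$ is $M$-approximately unital if it is approximately unital and $A$ is an $M$-ideal in $A^1$. *)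

(* Defs.v *)
From mathcomp Require Import all_boot all_algebra.
From mathcomp Require Import complex.
From mathcomp Require Import boolp classical_sets reals.
Set Implicit Arguments. Unset Strict Implicit. Unset Printing Implicit Defensive.
Import GRing.Theory Num.Theory.
Local Open Scope ring_scope.
Local Open Scope classical_set_scope.

Definition cabs {R : realType} (z : R[i]) : R := Normc.normc z.

Section BanachAlgebra.
Variables (R : realType) (A : lmodType R[i]).
Variables (mul : A -> A -> A) (nrm : A -> R).

Definition is_norm : Prop :=
  [/\ forall a, 0 <= nrm a,
      forall a, nrm a = 0 -> a = 0,
      forall a b, nrm (a + b) <= nrm a + nrm b &
      forall (k : R[i]) a, nrm (k *: a) = cabs k * nrm a].

Definition is_complete : Prop :=
  forall u : nat -> A,
    (forall e : R, 0 < e -> exists N, forall m n, (N <= m)%N -> (N <= n)%N ->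
        nrm (u m - u n) < e) ->
    exists l, forall e : R, 0 < e -> exists N, forall n, (N <= n)%N ->
        nrm (u n - l) < e.

Definition is_bilinear_assoc : Prop :=
  [/\ forall (k : R[i]) a b c, mul (k *: a + b) c = k *: mul a c + mul b c,
      forall (k : R[i]) a b c, mul c (k *: a + b) = k *: mul c a + mul c b &
      forall a b c, mul a (mul b c) = mul (mul a b) c].

Definition BanachAlgebra : Prop :=
  [/\ is_norm, is_complete, is_bilinear_assoc &
      forall a b, nrm (mul a b) <= nrm a * nrm b].

Definition unit_elt (u : A) : Prop :=
  (forall a, mul u a = a /\ mul a u = a) /\ nrm u = 1.

Definition unital : Prop := exists u, unit_elt u.

Definition approx_unital : Prop :=
  exists (I : Type) (le : I -> I -> Prop) (e : I -> A),
    [/\ (exists i : I, True),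
        (forall i, le i i),
        (forall i j k, le i j -> le j k -> le i k),
        (forall i j, exists k, le i k /\ le j k) &
        (forall i, nrm (e i) <= 1)] /\
        (forall a (eps : R), 0 < eps -> exists i0, forall i, le i0 i ->
          nrm (mul (e i) a - a) < eps /\ nrm (mul a (e i) - a) < eps).

(* The multiplier unitization A^1.  An element a + lambda 1 of A^1 is
   represented by the pair (a, lambda) : A * R[i].  If A is unital,
   A^1 = A and a + lambda 1 is the element a + lambda u of A (u the
   identity); otherwise A^1 = A + C1 with the multiplier norm. *)
Definition unit1 : A := xget 0 unit_elt.

Definition norm1 (a : A) (l : R[i]) : R :=
  if `[< unital >] then nrm (a + l *: unit1)
  else sup [set r : R | exists c, nrm c <= 1 /\ r = nrm (mul a c + l *: c)].

Definition lin1 (f : A -> R[i] -> R[i]) : Prop :=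
  forall (k : R[i]) a b l m, f (k *: a + b) (k * l + m) = k * f a l + f b m.

Definition dual1 (f : A -> R[i] -> R[i]) : Prop :=
  lin1 f /\ exists M : R, forall a l, cabs (f a l) <= M * norm1 a l.

Definition dnorm1 (f : A -> R[i] -> R[i]) : R :=
  sup [set r : R | exists a l, norm1 a l <= 1 /\ r = cabs (f a l)].

Definition state1 (f : A -> R[i] -> R[i]) : Prop :=
  [/\ dual1 f, dnorm1 f = 1 & f 0 1 = 1].

Definition in_rA (a : A) : Prop :=
  forall f, state1 f -> 0 <= Re (f a 0).

Definition in_FA (a : A) : Prop := norm1 (- a) 1 <= 1.

Definition in_halfFA (a : A) : Prop := in_FA (2%:R *: a).

(* The bidual (A^1)^** : bounded linear functionals on (A^1)^*.
   Elements are functions on A -> R[i] -> R[i]; only their values on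
   (A^1)^* matter. *)
Definition bidual1 (eta : (A -> R[i] -> R[i]) -> R[i]) : Prop :=
  (forall (k : R[i]) f g, dual1 f -> dual1 g ->
     eta (fun a l => k * f a l + g a l) = k * eta f + eta g) /\
  exists M : R, forall f, dual1 f -> cabs (eta f) <= M * dnorm1 f.

Definition bdnorm1 (eta : (A -> R[i] -> R[i]) -> R[i]) : R :=
  sup [set r : R | exists f, dual1 f /\ dnorm1 f <= 1 /\ r = cabs (eta f)].

Definition in_Aperp (f : A -> R[i] -> R[i]) : Prop :=
  dual1 f /\ forall a, f a 0 = 0.

Definition in_Aperpperp (eta : (A -> R[i] -> R[i]) -> R[i]) : Prop :=
  bidual1 eta /\ forall f, in_Aperp f -> eta f = 0.

Definition M_ideal_in_unitization : Prop :=
  exists P : ((A -> R[i] -> R[i]) -> R[i]) -> ((A -> R[i] -> R[i]) -> R[i]),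
    [/\
        forall eta, bidual1 eta -> in_Aperpperp (P eta),
        forall (k : R[i]) eta xi, bidual1 eta -> bidual1 xi ->
          forall f, dual1 f ->
            P (fun g => k * eta g + xi g) f = k * P eta f + P xi f,
        forall eta, in_Aperpperp eta -> forall f, dual1 f -> P eta f = eta f &
        forall eta, bidual1 eta ->
          bdnorm1 eta = Num.max (bdnorm1 (P eta))
                                (bdnorm1 (fun f => eta f - P eta f))].

Definition M_approx_unital : Prop :=
  approx_unital /\ M_ideal_in_unitization.

End BanachAlgebra.

(* Main.v *)
Require Import Defs.
From mathcomp Require Import all_boot all_order all_algebra.
From mathcomp Require Import complex.
From mathcomp Require Import boolp classical_sets reals.
From mathcomp Require Import ring lra.
Import Order.TTheory GRing.Theory Num.Theory.
Local Notation Re := complex.Re.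
Local Notation Im := complex.Im.
Local Open Scope ring_scope.
Local Open Scope complex_scope.
Local Open Scope classical_set_scope.

(* Let [P] be the [M]-projection and [e = P 1].  For [norm x < 1] the bidual element
   [1 - e +/- x] splits into the [M]-summand components [+/- x] and [1 - e], so its norm is
   at most 1.  If [c] in [A] satisfied [norm (1 - c +/- x) <= 1], then [(c + x) / 2] and
   [(c - x) / 2] would lie in [halfFA] and have difference [x].  Such a [c] is obtained by
   successive approximation: given [a] with [norm (1 - a +/- x) <= M], where
   [(1 - s) M + s norm x <= 1], the element [a + s (e - a)] of the bidual satisfies both
   constraints exactly, and local reflexivity replaces the small correction [s (e - a)] by
   an element of [A] of almost the same norm, satisfying them up to an arbitrary error.
   Since [norm x < 1], one can take [s = 2^-n], and the approximations converge.  All of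
   this only uses that [norm1] is a seminorm extending [nrm] with [norm1 0 1 <= 1], so
   the unital case needs no separate treatment. *)

(** * The real Hahn-Banach theorem for sublinear functionals *)

Section HahnBanach.
Context {R : realType} {V : lmodType R[i]}.
Implicit Types (p q : V -> R) (x y v : V) (t s : R).

Definition sublinear p : Prop :=
  (forall x y, p (x + y) <= p x + p y) /\
  (forall t x, 0 < t -> p (t%:C *: x) <= t * p x).

Lemma scaleC_K t x : 0 < t -> t^-1%:C *: (t%:C *: x) = x.
Proof. by move=> t0; rewrite scalerA -rmorphM/= mulVf ?gt_eqF// scale1r. Qed.

Lemma sublinearZ {p t} x : sublinear p -> 0 < t -> p (t%:C *: x) = t * p x.
Proof.
move=> [_ pZ] t0; apply/eqP; rewrite eq_le pZ//=.
have := pZ t^-1 (t%:C *: x).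
by rewrite scaleC_K// invr_gt0 => /(_ t0); rewrite ler_pdivlMl.
Qed.

Lemma sublinear0 {p} : sublinear p -> p 0 = 0.
Proof.
move=> ps; have := sublinearZ 0 ps (ltr0Sn R 1); rewrite scaler0; lra.
Qed.

Lemma sublinearN {p} x : sublinear p -> - p (- x) <= p x.
Proof.
move=> ps; have := ps.1 x (- x).
by rewrite subrr (sublinear0 ps) -lerBlDr sub0r.
Qed.

Definition ray_values q v x : set R :=
  [set r | exists2 t, 0 <= t & r = q (x + t%:C *: v) - t * q v].

(** For sublinear [q], a sublinear minorant of [q] whose value at [- v] is at most [- q v]; a linear
    functional below it is therefore at least [q v] at [v]. *)
Definition ray_inf q v x : R := inf (ray_values q v x).

Section RayInf.
Context (q : V -> R) (v : V).
Hypothesis qs : sublinear q.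

Let sublinearZ0 {t} x : 0 <= t -> q (t%:C *: x) = t * q x.
Proof.
rewrite le0r => /orP[/eqP->|/sublinearZ->//].
by rewrite scale0r (sublinear0 qs) mul0r.
Qed.

Let ray_lb x : lbound (ray_values q v x) (- q (- x)).
Proof.
move=> _ [t t0 ->]; have := qs.1 (x + t%:C *: v) (- x).
by rewrite addrAC subrr add0r (sublinearZ0 _ t0); lra.
Qed.

Let ray_inf_lb {x t} : 0 <= t -> ray_inf q v x <= q (x + t%:C *: v) - t * q v.
Proof. by move=> t0; apply: ge_inf; [exists (- q (- x))|exists t]. Qed.

Let le_ray_inf {x m} :
  (forall t, 0 <= t -> m <= q (x + t%:C *: v) - t * q v) -> m <= ray_inf q v x.
Proof.
move=> h; apply: lb_le_inf => [|_ [t t0 ->]]; last exact: h.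
by exists (q (x + 0%:C *: v) - 0 * q v), 0.
Qed.

Lemma sublinear_ray_inf : sublinear (ray_inf q v).
Proof.
split=> [x y|s x s0].
  rewrite -lerBlDr; apply: le_ray_inf => t t0.
  rewrite lerBlDr -lerBlDl; apply: le_ray_inf => u u0.
  have := ray_inf_lb (x := x + y) (addr_ge0 t0 u0).
  have := qs.1 (x + t%:C *: v) (y + u%:C *: v).
  rewrite rmorphD/= scalerDl addrACA; lra.
rewrite -ler_pdivrMl//; apply: le_ray_inf => t t0.
rewrite ler_pdivrMl// mulrBr -(sublinearZ _ qs s0).
have := ray_inf_lb (x := s%:C *: x) (mulr_ge0 (ltW s0) t0).
by rewrite rmorphM/= scalerDr scalerA -mulrA.
Qed.

Lemma ray_inf_le x : ray_inf q v x <= q x.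
Proof.
by have := ray_inf_lb (x := x) (lexx 0); rewrite scale0r addr0 mul0r subr0.
Qed.

Lemma ray_inf_leB x : ray_inf q v x <= q (x + v) - q v.
Proof. by have := ray_inf_lb (x := x) ler01; rewrite scale1r mul1r. Qed.

End RayInf.

(** Zorn's lemma for the reversed pointwise order. A nonempty chain is bounded by its pointwise
    infimum, which is finite since every member is at least [- p (- x)] at [x]. *)
Lemma minimal_sublinear p : sublinear p ->
  exists2 q, sublinear q /\ (forall x, q x <= p x) &
    forall q', sublinear q' -> (forall x, q' x <= q x) -> q' = q.
Proof.
move=> ps; pose T := {q | sublinear q /\ forall x, q x <= p x}.
pose below (a b : T) := `[< forall x, sval b x <= sval a x >].
have [||||[q [qs qp]] qmin] := @Zorn T below.
- by move=> a; apply/asboolP => x.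
- move=> a b c /asboolP ab /asboolP bc; apply/asboolP => x.
  exact: le_trans (bc x) (ab x).
- move=> [a aP] [b bP] /asboolP /= ab /asboolP /= ba.
  by apply/eq_exist/funext => x; apply/eqP; rewrite eq_le ab ba.
- move=> F Ftot; have [[c0 Fc0]|F0] := pselect (exists c, F c); last first.
    exists (exist _ p (conj ps (fun x => lexx (p x)))) => s Fs.
    by case: F0; exists s.
  pose vals x := [set sval b x | b in F].
  pose m x := inf (vals x).
  have vals_lb x : lbound (vals x) (- p (- x)).
    move=> _ [[b [bs bp]] _ <-]/=.
    by apply: le_trans (sublinearN x bs); rewrite lerN2.
  have m_lb x b : F b -> m x <= sval b x.
    by move=> Fb; apply: ge_inf; [exists (- p (- x))|exists b].
  have le_m x r : (forall b, F b -> r <= sval b x) -> r <= m x.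
    move=> h; apply: lb_le_inf => [|_ [b Fb <-]]; last exact: h.
    by exists (sval c0 x), c0.
  have ms : sublinear m.
    split=> [x y|t x t0].
      rewrite -lerBlDr; apply: (le_m) => b Fb.
      rewrite lerBlDr -lerBlDl; apply: (le_m) => c Fc.
      (* Of two members of the chain, the smaller one serves as a bound at both [x] and [y]. *)
      rewrite lerBlDl; have [/asboolP bc|/asboolP cb] := Ftot b c Fb Fc.
        apply: le_trans (m_lb _ _ Fc) _.
        by apply: le_trans ((svalP c).1.1 x y) _; rewrite lerD2r.
      apply: le_trans (m_lb _ _ Fb) _.
      by apply: le_trans ((svalP b).1.1 x y) _; rewrite lerD2l.
    rewrite -ler_pdivrMl//; apply: (le_m) => b Fb; rewrite ler_pdivrMl//.
    by apply: le_trans (m_lb _ _ Fb) _; apply: (svalP b).1.2.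
  have mp x : m x <= p x := le_trans (m_lb x _ Fc0) ((svalP c0).2 x).
  exists (exist _ m (conj ms mp)) => b Fb; apply/asboolP => x; exact: m_lb.
- exists q => // q' q's q'q.
  have q'p x : q' x <= p x := le_trans (q'q x) (qp x).
  pose c : T := exist _ q' (conj q's q'p).
  have qc : below (exist _ q (conj qs qp)) c by exact/asboolP.
  by rewrite -[RHS](congr1 sval (qmin c qc)).
Qed.

Definition real_linear (g : V -> R) : Prop :=
  (forall x y, g (x + y) = g x + g y) /\ (forall t x, g (t%:C *: x) = t * g x).

(* A minimal sublinear functional coincides with each of its [ray_inf]s, hence is linear. *)
Theorem hahn_banach p v : sublinear p ->
  exists g, [/\ real_linear g, forall x, g x <= p x & g v = p v].
Proof.
(* Minimising below [ray_inf p v] rather than [p] gives [g (- v) <= - p v], hence [g v = p v]. *)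
move=> ps; have [g [gs gp] gmin] := minimal_sublinear _ (sublinear_ray_inf p v ps).
have gD x y : g (x + y) = g x + g y.
  have := ray_inf_leB g y gs x.
  rewrite (gmin _ (sublinear_ray_inf g y gs) (ray_inf_le g y gs)).
  by rewrite lerBrDr => gxy; apply/eqP; rewrite eq_le gs.1.
have g0 := sublinear0 gs.
have gN x : g (- x) = - g x.
  by apply/eqP; rewrite -addr_eq0 -gD addNr g0.
have gZ t x : g (t%:C *: x) = t * g x.
  have [t0|t0|<-] := ltgtP 0 t; first exact: sublinearZ.
    by rewrite -[t]opprK rmorphN/= scaleNr gN (sublinearZ x gs) ?oppr_gt0// !mulNr.
  by rewrite scale0r mul0r g0.
exists g; split=> // [x|]; first exact: le_trans (gp x) (ray_inf_le p v ps x).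
apply/eqP; rewrite eq_le (le_trans (gp v) (ray_inf_le p v ps v))/=.
have := le_trans (gp (- v)) (ray_inf_leB p v ps (- v)).
by rewrite addNr (sublinear0 ps) gN sub0r lerN2.
Qed.

End HahnBanach.

(** * The modulus of complex numbers *)

Section ComplexModulus.
Context {R : realType}.
Implicit Types (z w : R[i]) (t : R).

Lemma cabs_ge0 z : 0 <= cabs z.
Proof. by case: z => a b; exact: sqrtr_ge0. Qed.

Lemma cabs0 : cabs (0 : R[i]) = 0.
Proof. exact: Normc.normc0. Qed.

Lemma cabs1 : cabs (1 : R[i]) = 1.
Proof. exact: Normc.normc1. Qed.

Lemma cabs0_eq0 z : cabs z = 0 -> z = 0.
Proof. exact: Normc.eq0_normc. Qed.

Lemma cabsM z w : cabs (z * w) = cabs z * cabs w.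
Proof. exact: Normc.normcM. Qed.

Lemma cabsV z : cabs z^-1 = (cabs z)^-1.
Proof. exact: Normc.normcV. Qed.

Lemma cabsN z : cabs (- z) = cabs z.
Proof. exact: normcN. Qed.

Lemma cabsD z w : cabs (z + w) <= cabs z + cabs w.
Proof. exact: le_normcD. Qed.

Lemma cabs_real t : cabs t%:C = `|t|.
Proof. by rewrite /cabs /Normc.normc /= [0 ^+ 2]expr2 mulr0 addr0 sqrtr_sqr. Qed.

Lemma ReD z w : Re (z + w) = Re z + Re w.
Proof. by case: z w => [a b] [c d]. Qed.

Lemma ReZ t z : Re (t%:C * z) = t * Re z.
Proof. by case: z => a b /=; rewrite mul0r subr0. Qed.

Lemma Re_le_cabs z : Re z <= cabs z.
Proof.
case: z => a b; apply: le_trans (ler_norm a) _.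
by rewrite -sqrtr_sqr ler_wsqrtr// lerDl sqr_ge0.
Qed.

Lemma rotate_to_real z : exists2 u, cabs u = 1 & Re (u * z) = cabs z.
Proof.
have [->|z0] := eqVneq z 0; first by exists 1; rewrite ?cabs1// mulr0 cabs0.
exists ((cabs z)%:C / z); last by rewrite divfK.
rewrite cabsM cabsV cabs_real (ger0_norm (cabs_ge0 z)) divff//.
by apply: contra_neq z0; exact: cabs0_eq0.
Qed.

Lemma Re_sum (I : finType) (F : I -> R[i]) :
  Re (\sum_i F i) = \sum_i Re (F i).
Proof. exact: (big_morph _ ReD (erefl _)). Qed.

End ComplexModulus.

(** * Complex functionals from real ones *)

Section Complexification.
Context {R : realType} {V : lmodType R[i]}.

(** For real-linear [g], this is the only complex-linear functional with real part [g]. *)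
Definition complexify (g : V -> R) (x : V) : R[i] := g x +i* - g ('i *: x).

Lemma complexify_linear (g : V -> R) : real_linear g ->
  forall (k : R[i]) x y,
    complexify g (k *: x + y) = k * complexify g x + complexify g y.
Proof.
move=> [gD gZ] k x y; have Ekx : k *: x = (Re k)%:C *: x + (Im k)%:C *: ('i *: x).
  by rewrite {1}(complexE k) scalerDl mulrC scalerA.
have Eikx : 'i *: (k *: x) = (Re k)%:C *: ('i *: x) + (- Im k)%:C *: x.
  rewrite !scalerA -scalerDl; congr (_ *: _).
  by case: k {Ekx} => a b; simpc.
rewrite /complexify scalerDr !gD Eikx Ekx !gD !gZ.
case: k {Ekx Eikx} => a b /=; simpc; congr Complex; ring.
Qed.

(** Rotating [x] by a unimodular [u] turns the modulus of the value into the real part [g (u *: x)],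
    and [N] does not see the rotation. *)
Lemma cabs_complexify (g N : V -> R) :
  real_linear g -> (forall x, g x <= N x) ->
  (forall (k : R[i]) x, N (k *: x) = cabs k * N x) ->
  forall x, cabs (complexify g x) <= N x.
Proof.
move=> gl gN NZ x; have [u u1 <-] := rotate_to_real (complexify g x).
have := complexify_linear g gl u x 0.
rewrite addr0 {3}/complexify scaler0.
have -> : g 0 = 0 by have := gl.2 0 0; rewrite scaler0 mul0r.
rewrite oppr0 addr0 => <-; apply: le_trans (gN _) _.
by rewrite NZ u1 mul1r.
Qed.

End Complexification.

(** * The norm of the multiplier unitization *)

Section Unitization.
Context {R : realType} {A : lmodType R[i]}.
Context {mul : A -> A -> A} {nrm : A -> R}.
Hypothesis BA : BanachAlgebra mul nrm.
Implicit Types (a b c : A) (k l m : R[i]).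

Lemma nrm_ge0 a : 0 <= nrm a.
Proof. by have [[]] := BA. Qed.

Lemma nrmD a b : nrm (a + b) <= nrm a + nrm b.
Proof. by have [[]] := BA. Qed.

Lemma nrmZ k a : nrm (k *: a) = cabs k * nrm a.
Proof. by have [[]] := BA. Qed.

Lemma nrm0 : nrm 0 = 0.
Proof. by rewrite -(scale0r 0) nrmZ cabs0 mul0r. Qed.

Lemma nrmN a : nrm (- a) = nrm a.
Proof. by rewrite -scaleN1r nrmZ cabsN cabs1 mul1r. Qed.

Lemma nrm_mul a b : nrm (mul a b) <= nrm a * nrm b.
Proof. by have [] := BA. Qed.

Lemma mulDZl k a b c : mul (k *: a + b) c = k *: mul a c + mul b c.
Proof. by have [_ _ []] := BA. Qed.

Lemma mul0l a : mul 0 a = 0.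
Proof. by have := mulDZl (- 1) 0 0 a; rewrite scaler0 addr0 scaleN1r addNr. Qed.

Definition multiplier_values a l : set R :=
  [set r | exists c, nrm c <= 1 /\ r = nrm (mul a c + l *: c)].

Lemma multiplier_values_ub a l : has_ubound (multiplier_values a l).
Proof.
exists (nrm a + cabs l) => _ [c [c1 ->]].
apply: le_trans (nrmD _ _) _; rewrite nrmZ; apply: lerD.
  by apply: le_trans (nrm_mul _ _) _; rewrite ler_piMr ?nrm_ge0.
by rewrite ler_piMr ?cabs_ge0.
Qed.

Lemma le_multiplier {a l c} :
  nrm c <= 1 -> nrm (mul a c + l *: c) <= sup (multiplier_values a l).
Proof.
by move=> c1; apply: ub_le_sup; [exact: multiplier_values_ub|exists c].
Qed.

Lemma multiplier_le {a l r} :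
  (forall c, nrm c <= 1 -> nrm (mul a c + l *: c) <= r) ->
  sup (multiplier_values a l) <= r.
Proof.
move=> h; apply: ge_sup => [|_ [c [c1 ->]]]; last exact: h.
by exists (nrm (mul a 0 + l *: 0)), 0; rewrite nrm0 ler01.
Qed.

Lemma norm1E a l : norm1 mul nrm a l =
  if `[< unital mul nrm >] then nrm (a + l *: unit1 mul nrm)
  else sup (multiplier_values a l).
Proof. by []. Qed.

Lemma nrm_unit1 : unital mul nrm -> nrm (unit1 mul nrm) = 1.
Proof. by move=> [u uP]; have := @xgetPex _ 0 (unit_elt mul nrm) (ex_intro _ u uP) => -[]. Qed.

Lemma norm1_ge0 a l : 0 <= norm1 mul nrm a l.
Proof.
rewrite norm1E; case: asboolP => _; first exact: nrm_ge0.
have /(le_multiplier (a := a) (l := l)) : nrm 0 <= 1 by rewrite nrm0.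
by apply: le_trans; exact: nrm_ge0.
Qed.

Lemma norm1D a b l m :
  norm1 mul nrm (a + b) (l + m) <= norm1 mul nrm a l + norm1 mul nrm b m.
Proof.
rewrite !norm1E; case: asboolP => _.
  by rewrite scalerDl addrACA; exact: nrmD.
apply: multiplier_le => c c1.
have -> : mul (a + b) c = mul a c + mul b c.
  by have := mulDZl 1 a b c; rewrite !scale1r.
rewrite scalerDl addrACA; apply: le_trans (nrmD _ _) _.
by apply: lerD; exact: le_multiplier.
Qed.

Lemma norm1Z k a l :
  norm1 mul nrm (k *: a) (k * l) = cabs k * norm1 mul nrm a l.
Proof.
rewrite !norm1E; case: asboolP => _; first by rewrite -scalerA -scalerDr nrmZ.
have half k' a' l' : sup (multiplier_values (k' *: a') (k' * l')) <=
    cabs k' * sup (multiplier_values a' l').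
  apply: multiplier_le => c c1.
  have := mulDZl k' a' 0 c; rewrite addr0 mul0l addr0 => ->.
  rewrite -scalerA -scalerDr nrmZ.
  by apply: ler_wpM2l; [exact: cabs_ge0|exact: le_multiplier].
apply/eqP; rewrite eq_le half/=.
(* The reverse inequality is [half] for [k^-1], so [k = 0] is treated apart. *)
have [->|k0] := eqVneq k 0.
  rewrite cabs0 mul0r.
  have /(le_multiplier (a := 0 *: a) (l := 0 * l)) : nrm 0 <= 1 by rewrite nrm0.
  by apply: le_trans; exact: nrm_ge0.
have := half k^-1 (k *: a) (k * l); rewrite scalerA mulrA mulVf// scale1r mul1r.
rewrite cabsV ler_pdivlMl// lt_neqAle cabs_ge0 andbT eq_sym.
by apply: contra_neq k0; exact: cabs0_eq0.
Qed.

Lemma norm1_scale1 : norm1 mul nrm 0 1 <= 1.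
Proof.
rewrite !norm1E; case: asboolP => [u|_].
  by rewrite add0r scale1r nrm_unit1.
by apply: multiplier_le => c c1; rewrite mul0l add0r scale1r.
Qed.

(** In the nonunital case, testing on the contractive approximate identity shows that the multiplier
    norm is no smaller than [nrm a]. *)
Lemma norm1_nrm a : approx_unital mul nrm -> norm1 mul nrm a 0 = nrm a.
Proof.
move=> [I [le [e [[_ lexx _ _ e1] eP]]]].
rewrite !norm1E; case: asboolP => [u|_]; first by rewrite scale0r addr0.
apply/eqP; rewrite eq_le; apply/andP; split.
  apply: multiplier_le => c c1; rewrite scale0r addr0.
  by apply: le_trans (nrm_mul _ _) _; rewrite ler_piMr ?nrm_ge0.
apply/ler_addgt0Pr => eps eps0; have [i /(_ i (lexx i))[_ ei]] := eP a eps eps0.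
have := le_multiplier (a := a) (l := 0) (e1 i); rewrite scale0r addr0 => h.
rewrite -[a in nrm a](subrK (mul a (e i))) addrC.
apply: le_trans (nrmD _ _) _; apply: lerD => //.
by rewrite -opprB nrmN ltW.
Qed.

End Unitization.

(** * Dual and bidual of the unitization *)

Section Duality.
Context {R : realType} {A : lmodType R[i]}.
Context {mul : A -> A -> A} {nrm : A -> R}.
Hypothesis BA : BanachAlgebra mul nrm.
Implicit Types (a b : A) (k l m : R[i]) (f g : A -> R[i] -> R[i]).
Implicit Types (eta : (A -> R[i] -> R[i]) -> R[i]).

Local Notation N := (norm1 mul nrm).
Local Notation dual := (dual1 mul nrm).
Local Notation dnorm := (dnorm1 mul nrm).
Local Notation bidual := (bidual1 mul nrm).
Local Notation bdnorm := (bdnorm1 mul nrm).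

Lemma norm1_00 : N 0 0 = 0.
Proof. by have := norm1Z BA 0 0 0; rewrite scaler0 mulr0 cabs0 mul0r. Qed.

Lemma lin1_0 {f} : lin1 f -> f 0 0 = 0.
Proof.
move=> /(_ (- 1) 0 0 0 0).
by rewrite scaler0 addr0 mulr0 addr0 mulN1r addNr.
Qed.

Lemma lin1Z {f} k a l : lin1 f -> f (k *: a) (k * l) = k * f a l.
Proof.
by move=> fl; have := fl k a 0 l 0; rewrite !addr0 (lin1_0 fl) addr0.
Qed.

Lemma lin1D {f} a b l m : lin1 f -> f (a + b) (l + m) = f a l + f b m.
Proof. by move=> fl; have := fl 1 a b l m; rewrite scale1r !mul1r. Qed.

Lemma lin1D0 {f} a b : lin1 f -> f (a + b) 0 = f a 0 + f b 0.
Proof. by move=> fl; rewrite -lin1D// addr0. Qed.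

Lemma lin1Z0 {f} k a : lin1 f -> f (k *: a) 0 = k * f a 0.
Proof. by move=> fl; rewrite -lin1Z// mulr0. Qed.

Lemma lin1N0 {f} a : lin1 f -> f (- a) 0 = - f a 0.
Proof. by move=> fl; rewrite -scaleN1r lin1Z0// mulN1r. Qed.

Lemma lin1_split {f} a l : lin1 f -> f a l = f 0 l + f a 0.
Proof. by move=> fl; rewrite -lin1D// add0r addr0. Qed.

Lemma dual_has_sup {f} : dual f ->
  has_ubound [set r : R | exists a l, N a l <= 1 /\ r = cabs (f a l)].
Proof.
move=> [_ [M fM]]; exists `|M| => _ [a [l [al1 ->]]].
apply: le_trans (fM a l) _; apply: le_trans (ler_norm _) _.
by rewrite normrM (ger0_norm (norm1_ge0 BA _ _)) ler_piMr.
Qed.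

Lemma le_dnorm {f a l} : dual f -> N a l <= 1 -> cabs (f a l) <= dnorm f.
Proof.
by move=> fd al1; apply: ub_le_sup; [exact: dual_has_sup|exists a, l].
Qed.

Lemma dnorm1_ge0 {f} : dual f -> 0 <= dnorm f.
Proof.
move=> fd; apply: le_trans (cabs_ge0 (f 0 0)) (le_dnorm fd _).
by rewrite norm1_00.
Qed.

Lemma dnorm_le {f r} :
  (forall a l, N a l <= 1 -> cabs (f a l) <= r) -> dnorm f <= r.
Proof.
move=> h; apply: ge_sup => [|_ [a [l [al1 ->]]]]; last exact: h.
by exists (cabs (f 0 0)), 0, 0; rewrite norm1_00.
Qed.

Lemma dual_le {f} a l : dual f -> cabs (f a l) <= dnorm f * N a l.
Proof.
move=> fd; have [fl [M fM]] := fd.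
(* [N] is used only as a seminorm: a vector on which it vanishes cannot be normalised, and the bound
   [M] handles it. *)
have [N0|N0] := eqVneq (N a l) 0; first by have := fM a l; rewrite N0 !mulr0.
have Np : 0 < N a l by rewrite lt_neqAle eq_sym N0 norm1_ge0.
rewrite -ler_pdivrMr// mulrC.
have kN : cabs (N a l)^-1%:C = (N a l)^-1.
  by rewrite cabs_real gtr0_norm// invr_gt0.
rewrite -{1}kN -cabsM -lin1Z//; apply: le_dnorm => //.
by rewrite norm1Z// kN mulVf.
Qed.

Lemma dual_lin {k f g} : dual f -> dual g ->
  dual (fun a l => k * f a l + g a l).
Proof.
move=> fd gd; split=> [c a b l m|].
  by rewrite fd.1 gd.1; ring.
exists (cabs k * dnorm f + dnorm g) => a l; apply: le_trans (cabsD _ _) _.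
rewrite mulrDl cabsM -mulrA; apply: lerD; last exact: dual_le.
by apply: ler_wpM2l; [exact: cabs_ge0|exact: dual_le].
Qed.

Lemma dual0 : dual (fun _ _ => 0).
Proof.
split=> [k a b l m|]; first by rewrite mulr0 addr0.
by exists 0 => a l; rewrite cabs0 mul0r.
Qed.

Lemma dualZ {k f} : dual f -> dual (fun a l => k * f a l).
Proof.
move=> fd; have := dual_lin (k := k) fd dual0.
by congr (dual _); apply/funext => a; apply/funext => l; rewrite addr0.
Qed.

Lemma bidual0 {eta} : bidual eta -> eta (fun _ _ => 0) = 0.
Proof.
move=> [el _]; have := el (- 1) _ _ dual0 dual0.
rewrite [_ * eta _]mulN1r [_ + eta _]addNr => e0; rewrite -[RHS]e0; congr (eta _).
by apply/funext => a; apply/funext => l; rewrite mulr0 addr0.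
Qed.

Lemma bidualZ {eta k f} : bidual eta -> dual f ->
  eta (fun a l => k * f a l) = k * eta f.
Proof.
move=> eb fd; rewrite -[RHS]addr0 -(bidual0 eb) -(eb.1 _ _ _ fd dual0).
by congr (eta _); apply/funext => a; apply/funext => l; rewrite addr0.
Qed.

(** Both claims go through one induction because [eta] is additive only on members of the dual. *)
Lemma bidual_sum {I : Type} (s : seq I) (f : I -> A -> R[i] -> R[i]) :
  (forall i, dual (f i)) ->
  dual (fun a l => \sum_(i <- s) f i a l) /\
  forall eta, bidual eta ->
    eta (fun a l => \sum_(i <- s) f i a l) = \sum_(i <- s) eta (f i).
Proof.
move=> fd; elim: s => [|i s [sd es]].
  have -> : (fun a l => \sum_(i <- [::]) f i a l) = (fun _ _ => 0).
    by apply/funext => a; apply/funext => l; rewrite big_nil.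
  by split=> [|eta eb]; [exact: dual0|rewrite big_nil bidual0].
have -> : (fun a l => \sum_(j <- i :: s) f j a l) =
    (fun a l => 1 * f i a l + \sum_(j <- s) f j a l).
  by apply/funext => a; apply/funext => l; rewrite big_cons mul1r.
split=> [|eta eb]; first exact: dual_lin.
by rewrite eb.1// mul1r big_cons es.
Qed.

Lemma bidual_le {eta f} : bidual eta -> dual f ->
  cabs (eta f) <= bdnorm eta * dnorm f.
Proof.
move=> eb fd; have [_ [M eM]] := eb.
have [d0|d0] := eqVneq (dnorm f) 0; first by have := eM f fd; rewrite d0 !mulr0.
have dp : 0 < dnorm f by rewrite lt_neqAle eq_sym d0 dnorm1_ge0.
rewrite -ler_pdivrMr// mulrC.
have kd : cabs (dnorm f)^-1%:C = (dnorm f)^-1.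
  by rewrite cabs_real gtr0_norm// invr_gt0.
rewrite -{1}kd -cabsM -bidualZ//; apply: ub_le_sup.
  exists `|M| => _ [g [gd [g1 ->]]].
  apply: le_trans (eM g gd) _; apply: le_trans (ler_norm _) _.
  by rewrite normrM (ger0_norm (dnorm1_ge0 gd)) ler_piMr.
exists (fun a l => (dnorm f)^-1%:C * f a l); split; first exact: dualZ.
split=> //; apply: dnorm_le => a l al1.
rewrite cabsM kd ler_pdivrMl// mulr1; exact: le_dnorm.
Qed.

Lemma bdnorm_le {eta r} : 0 <= r ->
  (forall f, dual f -> cabs (eta f) <= r * dnorm f) -> bdnorm eta <= r.
Proof.
move=> r0 h; apply: ge_sup => [|_ [f [fd [f1 ->]]]].
  exists (cabs (eta (fun _ _ => 0))), (fun _ _ => 0); split; first exact: dual0.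
  by split=> //; apply: dnorm_le => a l _; rewrite cabs0.
by apply: le_trans (h f fd) _; rewrite ler_piMr.
Qed.

(** * Local reflexivity for finitely many balls *)

Section LocalReflexivity.
Context {I : finType} (r : I -> R).
Hypothesis r0 : forall i, 0 < r i.

Local Notation V := {ffun I -> A * R[i]}.
Implicit Types (z w : V) (s t : R).

Definition gauge_values z : set R :=
  [set s | 0 <= s /\
    exists a, forall i, N ((z i).1 - a) (z i).2 <= r i * s].

(** The quotient seminorm on a product of copies of the unitization modulo the diagonal of [A], for
    the maximum norm with weights [(r i)^-1]. *)
Definition gauge z : R := inf (gauge_values z).

Let gauge_lb {z s} : gauge_values z s -> gauge z <= s.
Proof. by move=> zs; apply: ge_inf => //; exists 0 => ? []. Qed.

Let le_gauge {z} {m : R} : (forall s, gauge_values z s -> m <= s) -> m <= gauge z.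
Proof.
move=> h; apply: lb_le_inf => [|s zs]; last exact: h.
have q0 i : 0 <= N (z i).1 (z i).2 / r i.
  by rewrite divr_ge0// ?norm1_ge0// ltW.
exists (\sum_i N (z i).1 (z i).2 / r i); split; first exact: sumr_ge0.
exists 0 => i; rewrite subr0 (bigD1 i)//= -ler_pdivrMl// mulrC lerDl.
exact: sumr_ge0.
Qed.

Lemma gauge_sublinear : sublinear gauge.
Proof.
split=> [z w|t z t0].
  rewrite -lerBlDr; apply: le_gauge => s [s0 [a za]].
  rewrite lerBlDr -lerBlDl; apply: le_gauge => u [u0 [b wb]].
  rewrite lerBlDl; apply: gauge_lb; split; first exact: addr_ge0.
  exists (a + b) => i; rewrite ffunE/= opprD addrACA mulrDr.
  by apply: le_trans (norm1D BA _ _ _ _) _; exact: lerD.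
rewrite -ler_pdivrMl//; apply: le_gauge => s [s0 [a za]].
rewrite ler_pdivrMl//; apply: gauge_lb; split; first by rewrite mulr_ge0// ltW.
exists (t%:C *: a) => i; rewrite ffunE/= -scalerBr norm1Z// cabs_real gtr0_norm//.
by rewrite mulrCA ler_pM2l.
Qed.

Lemma gauge_le {z s} a : 0 <= s ->
  (forall i, N ((z i).1 - a) (z i).2 <= r i * s) -> gauge z <= s.
Proof. by move=> s0 za; apply: gauge_lb; split=> //; exists a. Qed.

Definition inj_coord (i : I) (x : A * R[i]) : V :=
  [ffun j => if j == i then x else 0].

Lemma inj_coordD i x y : inj_coord i (x + y) = inj_coord i x + inj_coord i y.
Proof. by apply/ffunP => j; rewrite !ffunE; case: eqP => // _; rewrite addr0. Qed.

Lemma inj_coordZ i k x : inj_coord i (k *: x) = k *: inj_coord i x.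
Proof. by apply/ffunP => j; rewrite !ffunE; case: eqP => // _; rewrite scaler0. Qed.

Lemma sum_inj_coord z : z = \sum_i inj_coord i (z i).
Proof.
apply/ffunP => j; rewrite sum_ffunE (bigD1 j)//= big1 ?addr0 => [|i ij].
  by rewrite ffunE eqxx.
by rewrite ffunE eq_sym (negbTE ij).
Qed.

Section GaugeFunctional.
Context (G : V -> R).
Hypotheses (Gl : real_linear G) (G_le : forall z, G z <= gauge z).

Definition coord_functional (i : I) a l : R[i] :=
  complexify (G \o inj_coord i) (a, l).

Let real_linear_coord i : real_linear (G \o inj_coord i).
Proof.
split=> [x y|t x]/=; first by rewrite inj_coordD Gl.1.
by rewrite inj_coordZ Gl.2.
Qed.

Let G_sum z : G z = \sum_i G (inj_coord i (z i)).
Proof.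
have G0 : G 0 = 0 by have := Gl.2 0 0; rewrite scaler0 mul0r.
by rewrite {1}(sum_inj_coord z) (big_morph _ Gl.1 G0).
Qed.

Lemma dual_coord_functional i : dual (coord_functional i).
Proof.
split=> [k a b l m|]; first exact: (complexify_linear _ (real_linear_coord i) k (a, l) (b, m)).
exists (r i)^-1 => a l.
apply: (cabs_complexify _ (fun x => (r i)^-1 * N x.1 x.2) (real_linear_coord i)).
  move=> x /=; apply: le_trans (G_le _) _.
  have c0 : 0 <= (r i)^-1 * N x.1 x.2.
    by rewrite mulr_ge0 ?norm1_ge0// invr_ge0 ltW.
  apply: (gauge_le 0) => // j; rewrite ffunE; case: eqP => [->|_].
    by rewrite subr0 mulVKf ?gt_eqF.
  by rewrite subr0 norm1_00 mulr_ge0// ltW.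
by move=> k x /=; rewrite norm1Z// mulrCA.
Qed.

Lemma Re_coord_functional i a l :
  Re (coord_functional i a l) = G (inj_coord i (a, l)).
Proof. by []. Qed.

Lemma sum_Re_coord z :
  \sum_i Re (coord_functional i (z i).1 (z i).2) = G z.
Proof.
rewrite G_sum; apply: eq_bigr => i _.
by rewrite Re_coord_functional -surjective_pairing.
Qed.

(** The gauge vanishes on the diagonal of [A], so [G] is nonpositive there and, applied to opposite
    vectors, zero. A rotation reduces the complex claim to this real one. *)
Lemma sum_coord_Aperp :
  in_Aperp mul nrm (fun a l => \sum_i coord_functional i a l).
Proof.
have [sd _] := bidual_sum (index_enum I) coord_functional dual_coord_functional.
split=> // a; apply: cabs0_eq0.
have [u u1 <-] := rotate_to_real (\sum_i coord_functional i a 0).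
rewrite -(lin1Z _ _ _ sd.1) mulr0 Re_sum.
have G_le0 b : G [ffun _ => (b, 0)] <= 0.
  apply: le_trans (G_le _) _; apply: (gauge_le b) => // i.
  by rewrite ffunE/= subrr norm1_00 mulr0.
have -> : \sum_i Re (coord_functional i (u *: a) 0) = G [ffun _ => (u *: a, 0)].
  by rewrite -sum_Re_coord; apply: eq_bigr => i _; rewrite ffunE.
apply/eqP; rewrite eq_le G_le0/= -oppr_le0.
have <- : G [ffun _ => (- (u *: a), 0)] = - G [ffun _ => (u *: a, 0)].
  rewrite -mulN1r -Gl.2; congr (G _); apply/ffunP => i; rewrite !ffunE.
  by rewrite rmorphN/= scaleN1r; congr pair; rewrite oppr0.
exact: G_le0.
Qed.

(** The weighted l1 norm is dual to the weighted maximum norm: vectors that almost norm each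
    component, rotated so that the values add up and scaled by [r i], form one [w] with
    [gauge w <= 1]. *)
Lemma sum_dnorm_coord : \sum_i r i * dnorm (coord_functional i) <= 1.
Proof.
apply/ler_addgt0Pr => e e0.
have S0 : 0 <= \sum_i r i by apply: sumr_ge0 => i _; exact: ltW.
(* Makes the total error [e' * \sum_i r i] at most [e]; the summand 1 keeps the denominator positive
   even for empty [I]. *)
pose e' := e / (1 + \sum_i r i).
have e'0 : 0 < e' by rewrite divr_gt0// ltr_pwDl.
have near i : exists x : A * R[i], N x.1 x.2 <= 1 /\
    dnorm (coord_functional i) - e' <= Re (coord_functional i x.1 x.2).
  have fd := dual_coord_functional i.
  have [|_ [a [l [al1 ->]]] lt_al] := sup_adherent e'0 (_ : has_sup
      [set s : R | exists a l, N a l <= 1 /\ s = cabs (coord_functional i a l)]).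
    split; last exact: dual_has_sup.
    by exists (cabs (coord_functional i 0 0)), 0, 0; rewrite norm1_00.
  have [u u1 uE] := rotate_to_real (coord_functional i a l).
  exists (u *: a, u * l); rewrite /= norm1Z// u1 mul1r; split=> //.
  by rewrite -Re_coord_functional (lin1Z u a l fd.1) uE ltW.
have [x xP] := choice near.
pose w : V := [ffun i => (r i)%:C *: x i].
have Gw : G w <= 1.
  apply: le_trans (G_le w) _; apply: (gauge_le 0) => // i.
  rewrite ffunE/= subr0 norm1Z// cabs_real gtr0_norm// ler_pM2l//.
  exact: (xP i).1.
apply: le_trans (lerD Gw (lexx e)); rewrite -lerBlDr -sum_Re_coord.
have -> : \sum_i Re (coord_functional i (w i).1 (w i).2) =
    \sum_i r i * Re (coord_functional i (x i).1 (x i).2).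
  apply: eq_bigr => i _; rewrite ffunE (lin1Z _ _ _ (dual_coord_functional i).1).
  exact: ReZ.
apply: (@le_trans _ _ (\sum_i r i * (dnorm (coord_functional i) - e'))).
  rewrite (eq_bigr _ (fun i _ => mulrBr (r i) _ _)) sumrB lerB// -mulr_suml.
  by rewrite mulrCA ler_piMr ?(ltW e0)// ler_pdivrMr ?mul1r ?lerDr// ltr_pwDl.
by apply: ler_sum => i _; rewrite ler_pM2l//; exact: (xP i).2.
Qed.

End GaugeFunctional.

(* Principle of local reflexivity: [inf {s | balls B(z_i, s r_i) meet in A}] is
   attained by a functional of norm at most 1 that vanishes on the diagonal of [A], hence
   on that of [A^perpperp]. *)
Lemma approx_in_A z eta : in_Aperpperp mul nrm eta ->
  (forall i f, dual f ->
    cabs (f (z i).1 (z i).2 - eta f) <= r i * dnorm f) ->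
  forall d, 0 < d ->
    exists a, forall i, N ((z i).1 - a) (z i).2 <= r i * (1 + d).
Proof.
move=> [eb e0] ze d d0.
have [G [Gl G_le Gz]] := hahn_banach gauge z gauge_sublinear.
pose f i := coord_functional G i.
have fd i : dual (f i) := dual_coord_functional G Gl G_le i.
have [sd se] := bidual_sum (index_enum I) f fd.
have e_sum : \sum_i eta (f i) = 0.
  by rewrite -se// e0//; exact: sum_coord_Aperp.
have z1 : gauge z <= 1.
  (* The values [eta (f i)] sum to 0, so subtracting them costs nothing and brings in the hypothesis
     on each component. *)
  have -> : gauge z = Re (\sum_i (f i (z i).1 (z i).2 - eta (f i))).
    by rewrite -Gz sumrB e_sum subr0 Re_sum -sum_Re_coord.
  rewrite Re_sum.
  apply: le_trans (sum_dnorm_coord G Gl G_le).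
  by apply: ler_sum => i _; apply: le_trans (Re_le_cabs _) (ze i _ (fd i)).
have [|s [s0 [a za]] sd1] := @inf_adherent _ (gauge_values z) d d0.
  split; last by exists 0 => ? [].
  (* With no admissible [s], [le_gauge] would yield every lower bound; 2 already contradicts
     [z1]. *)
  apply: contrapT => /set0P/negP; rewrite negbK => /eqP E.
  suff : (2 : R) <= gauge z by lra.
  by apply: le_gauge => s; rewrite E.
exists a => i; apply: le_trans (za i) _; rewrite ler_pM2l// ltW//.
by apply: lt_le_trans sd1 _; rewrite lerD2r.
Qed.

End LocalReflexivity.
End Duality.

(** * Evaluations as elements of the bidual *)

Section MIdeal.
Context {R : realType} {A : lmodType R[i]}.
Context {mul : A -> A -> A} {nrm : A -> R}.
Hypotheses (BA : BanachAlgebra mul nrm) (AU : approx_unital mul nrm).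
Implicit Types (a x : A) (k l : R[i]) (s t d M : R) (f : A -> R[i] -> R[i]).
Implicit Types (eta xi : (A -> R[i] -> R[i]) -> R[i]).

Local Notation N := (norm1 mul nrm).
Local Notation dual := (dual1 mul nrm).
Local Notation dnorm := (dnorm1 mul nrm).
Local Notation bidual := (bidual1 mul nrm).
Local Notation bdnorm := (bdnorm1 mul nrm).
Local Notation App := (in_Aperpperp mul nrm).

Lemma bidual_eval a l : bidual (fun f => f a l).
Proof. by split=> //; exists (N a l) => f fd; rewrite mulrC; exact: (dual_le BA). Qed.

Lemma Aperpperp_eval a : App (fun f => f a 0).
Proof. by split=> [|f [_ fA]]; [exact: bidual_eval|exact: fA]. Qed.

Lemma bidual_lin k eta xi : bidual eta -> bidual xi ->
  bidual (fun f => k * eta f + xi f).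
Proof.
move=> eb xb; split=> [c f g fd gd|]; first by rewrite eb.1// xb.1//; ring.
exists (cabs k * bdnorm eta + bdnorm xi) => f fd; apply: le_trans (cabsD _ _) _.
rewrite mulrDl cabsM -mulrA; apply: lerD; last exact: (bidual_le BA).
by apply: ler_wpM2l; [exact: cabs_ge0|exact: bidual_le].
Qed.

(** * Estimates from the M-projection *)

Section Projection.
Context (P : ((A -> R[i] -> R[i]) -> R[i]) -> ((A -> R[i] -> R[i]) -> R[i])).
Hypothesis P_Aperpperp : forall eta, bidual eta -> App (P eta).
Hypothesis P_lin : forall k eta xi, bidual eta -> bidual xi ->
  forall f, dual f -> P (fun g => k * eta g + xi g) f = k * P eta f + P xi f.
Hypothesis P_id : forall eta, App eta -> forall f, dual f -> P eta f = eta f.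
Hypothesis P_max : forall eta, bidual eta ->
  bdnorm eta = Num.max (bdnorm (P eta)) (bdnorm (fun f => eta f - P eta f)).

Definition unit_proj : (A -> R[i] -> R[i]) -> R[i] := P (fun f => f 0 1).
Local Notation e := unit_proj.

Lemma unit_proj_Aperpperp : App e.
Proof. exact/P_Aperpperp/bidual_eval. Qed.

(* On non-linear arguments this differs from [fun f => f a 1]; [P_lin] applies only
   to this form. *)
Definition eval_unit_plus a f : R[i] := 1 * f 0 1 + f a 0.

Lemma eval_unit_plusE a f : dual f -> eval_unit_plus a f = f a 1.
Proof.
by move=> fd; rewrite /eval_unit_plus mul1r -(lin1_split _ _ fd.1).
Qed.

Lemma bidual_unit_plus a : bidual (eval_unit_plus a).
Proof. by apply: bidual_lin; exact: bidual_eval. Qed.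

Lemma P_unit_plus a f : dual f -> P (eval_unit_plus a) f = e f + f a 0.
Proof.
move=> fd; rewrite P_lin//; [|exact: bidual_eval..].
by rewrite mul1r [P (fun g => g a 0) f]P_id//; exact: Aperpperp_eval.
Qed.

Lemma bdnorm_unit_plus a : bdnorm (eval_unit_plus a) <= N a 1.
Proof.
apply: bdnorm_le => // [|f fd]; first exact: (norm1_ge0 BA).
by rewrite eval_unit_plusE// mulrC; exact: (dual_le BA).
Qed.

(** By [P_max] the projection is contractive, and it sends [1 + a] to [e + a] because it fixes
    [A]. *)
Lemma unit_proj_le a f : dual f -> cabs (e f + f a 0) <= N a 1 * dnorm f.
Proof.
move=> fd; have ub := bidual_unit_plus a.
rewrite -P_unit_plus//.
apply: le_trans (bidual_le BA (P_Aperpperp _ ub).1 fd) _.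
apply: ler_wpM2r; first exact: dnorm1_ge0.
apply: le_trans (bdnorm_unit_plus a).
by rewrite (P_max _ ub) le_max lexx.
Qed.

(** The complementary projection is contractive as well, and the identity has norm at most 1. *)
Lemma unit_coproj_le f : dual f -> cabs (f 0 1 - e f) <= dnorm f.
Proof.
move=> fd; have ub := bidual_unit_plus 0; have Pb := (P_Aperpperp _ ub).1.
have cb : bidual (fun g => eval_unit_plus 0 g - P (eval_unit_plus 0) g).
  have := bidual_lin (- 1) _ _ Pb ub.
  by congr (bidual _); apply/funext => g; rewrite mulN1r addrC.
have := bidual_le BA cb fd.
rewrite eval_unit_plusE// P_unit_plus// (lin1_0 fd.1) addr0 => /le_trans; apply.
rewrite ler_piMl ?(dnorm1_ge0 BA)//; apply: le_trans (norm1_scale1 BA).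
by apply: le_trans (bdnorm_unit_plus 0); rewrite (P_max _ ub) le_max lexx orbT.
Qed.

(* The [M]-summand splitting of [1 - a + x - s(e - a)] is
   [(1 - s)(e - a + x) + s x] plus [1 - e]. *)
Lemma shift_le x a s M f :
  0 <= s <= 1 -> N (x - a) 1 <= M -> (1 - s) * M + s * nrm x <= 1 ->
  dual f ->
  cabs (f (x - a) 1 - s%:C * (e f - f a 0)) <= dnorm f.
Proof.
move=> /andP[s0 s1] NM sM fd.
have fl := fd.1.
(* [zeta] is [1 - a + x - s(e - a)] regrouped as [- s e + (1 + v)], a combination to which [P_lin]
   applies. *)
pose v := x - a + s%:C *: a.
pose zeta := fun g : A -> R[i] -> R[i] => (- s%:C) * e g + eval_unit_plus v g.
have zb : bidual zeta.
  by apply: bidual_lin; [exact: unit_proj_Aperpperp.1|exact: bidual_unit_plus].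
have Pz g : dual g -> P zeta g = (- s%:C) * e g + (e g + g v 0).
  move=> gd; rewrite P_lin//.
  - by rewrite P_unit_plus// [P e g]P_id//; exact: unit_proj_Aperpperp.
  - exact: unit_proj_Aperpperp.1.
  - exact: bidual_unit_plus.
have -> : f (x - a) 1 - s%:C * (e f - f a 0) = zeta f.
  rewrite /zeta /eval_unit_plus (lin1_split (x - a) 1 fl).
  by rewrite /v !(lin1D0 _ _ fl) (lin1N0 _ fl) (lin1Z0 _ _ fl); ring.
apply: le_trans (bidual_le BA zb fd) _.
rewrite ler_piMl ?(dnorm1_ge0 BA)//.
rewrite (P_max _ zb) ge_max; apply/andP; split; apply: bdnorm_le => // g gd.
  rewrite Pz//.
  have gl := gd.1.
  have -> : (- s%:C) * e g + (e g + g v 0) =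
      (1 - s)%:C * (e g + g (x - a) 0) + s%:C * g x 0.
    rewrite /v !(lin1D0 _ _ gl) (lin1N0 _ gl) (lin1Z0 _ _ gl).
    by rewrite rmorphB/=; ring.
  apply: le_trans (cabsD _ _) _; rewrite !cabsM !cabs_real !ger0_norm ?subr_ge0//.
  apply: (@le_trans _ _ (((1 - s) * M + s * nrm x) * dnorm g)); last first.
    by apply: ler_wpM2r => //; exact: (dnorm1_ge0 BA).
  rewrite [X in _ <= X]mulrDl -!mulrA; apply: lerD; apply: ler_wpM2l; rewrite ?subr_ge0//.
    apply: le_trans (unit_proj_le _ _ gd) _.
    by apply: ler_wpM2r => //; exact: (dnorm1_ge0 BA).
  by rewrite -(norm1_nrm BA)// mulrC; exact: (dual_le BA).
rewrite Pz// /zeta /eval_unit_plus mul1r.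
have -> : - s%:C * e g + (g 0 1 + g v 0) - (- s%:C * e g + (e g + g v 0)) =
  g 0 1 - e g by ring.
by rewrite mul1r; exact: unit_coproj_le.
Qed.

(** Local reflexivity is applied to [s(e - a)] and three balls: those of radius 1 about [1 - a + x]
    and [1 - a - x] contain it by [shift_le], and the one of radius [s M] about 0 keeps the
    correction of [a] small. *)
Lemma center_step x a s M d :
  0 < s <= 1 -> 0 < M -> 0 < d ->
  N (x - a) 1 <= M -> N (- x - a) 1 <= M -> (1 - s) * M + s * nrm x <= 1 ->
  exists a', [/\ N (x - a') 1 <= 1 + d, N (- x - a') 1 <= 1 + d &
    nrm (a' - a) <= s * M * (1 + d)].
Proof.
move=> /andP[s0 s1] M0 d0 Nx NNx sM.
(* Averaging the two hypotheses removes [x]; through [unit_proj_le] this bounds [e - a] by [M]. *)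
have Na : N (- a) 1 <= M.
  have := le_trans (norm1D BA (x - a) (- x - a) 1 1) (lerD Nx NNx).
  have -> : x - a + (- x - a) = 2%:R%:C *: - a.
    by rewrite addrACA subrr add0r rmorphMn rmorph1 scaler_nat.
  have -> : (1 + 1 : R[i]) = 2%:R%:C * 1 by rewrite mulr1 rmorphMn rmorph1.
  by rewrite norm1Z// cabs_real normr_nat; lra.
have sub_le f : dual f -> cabs (e f - f a 0) <= M * dnorm f.
  move=> fd; have := unit_proj_le (- a) f fd.
  rewrite (lin1N0 _ fd.1) => /le_trans; apply.
  by apply: ler_wpM2r => //; exact: dnorm1_ge0.
pose I := option bool.
pose r (i : I) : R := if i is None then s * M else 1.
pose z : {ffun I -> A * R[i]} := [ffun i =>
  match i with None => (0, 0) | Some true => (x - a, 1)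
             | Some false => (- x - a, 1) end].
pose eta := fun f : A -> R[i] -> R[i] => s%:C * (e f - f a 0).
have etaA : App eta.
  split=> [|f fA]; last by rewrite /eta unit_proj_Aperpperp.2// fA.2 subr0 mulr0.
  split=> [k f g fd gd|]; first by rewrite /eta unit_proj_Aperpperp.1.1//; ring.
  exists (s * M) => f fd; rewrite cabsM cabs_real gtr0_norm// -mulrA ler_pM2l//.
  exact: sub_le.
have r0 i : 0 < r i by case: i => //=; exact: mulr_gt0.
have s01 : 0 <= s <= 1 by rewrite ltW.
have [|a' a'P] := approx_in_A BA r r0 z eta etaA _ d d0.
  move=> [[]|] f fd; rewrite ffunE/= ?mul1r.
  - by apply: (shift_le _ _ _ M).
  - by apply: (shift_le _ _ _ M) => //; rewrite (nrmN BA).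
  - rewrite (lin1_0 fd.1) sub0r cabsN cabsM cabs_real gtr0_norm// -mulrA ler_pM2l//.
    exact: sub_le.
exists (a + a'); split.
- by have := a'P (Some true); rewrite ffunE/= mul1r opprD addrA.
- by have := a'P (Some false); rewrite ffunE/= mul1r opprD addrA.
- have := a'P None; rewrite ffunE/= sub0r (norm1_nrm BA _ AU) (nrmN BA).
  by rewrite addrAC subrr add0r.
Qed.


(** * Successive approximation of the center *)

Section Iteration.
Context (x : A).
Hypothesis x1 : nrm x < 1.

Let scale (n : nat) : R := 2%:R^-1 ^+ n.

Let scale_gt0 n : 0 < scale n.
Proof. by rewrite exprn_gt0// invr_gt0. Qed.

Let scaleS n : scale n.+1 = scale n / 2%:R.
Proof. by rewrite /scale exprSr. Qed.

Let scale_le1 n : scale n <= 1.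
Proof. by rewrite exprn_ile1 ?invr_ge0// invf_le1// ler1n. Qed.

Let scale_small d : 0 < d -> exists n, scale n < d.
Proof.
move=> d0; exists (Num.bound d^-1).
rewrite /scale exprVn -[ltRHS]invrK ltf_pV2 ?posrE ?invr_gt0 ?exprn_gt0//.
apply: lt_le_trans (archi_boundP _) _; first by rewrite invr_ge0 ltW.
by rewrite -natrX ler_nat ltnW// ltn_expl.
Qed.

(** The last inequality is the one [center_step] asks for with [s = scale n]; the uniform bound 2 on
    [M] makes the corrections decay like [scale n]. *)
Definition near_center (n : nat) a : Prop :=
  exists M, [/\ 0 < M <= 2%:R, N (x - a) 1 <= M, N (- x - a) 1 <= M &
    (1 - scale n) * M + scale n * nrm x <= 1].

(** As [scale 0 = 1], the last inequality does not restrict [M], and the crude bound 2 will do. *)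
Let near_center0 : near_center 0 0.
Proof.
have N1 b : nrm b = nrm x -> N (b - 0) 1 <= 2%:R.
  move=> bx; have := norm1D BA b 0 0 1.
  rewrite (norm1_nrm BA _ AU) addr0 add0r subr0 bx.
  move: x1 (norm1_scale1 BA); lra.
exists 2%:R; split; rewrite ?lexx ?ltr0n//; [exact: N1|exact/N1/(nrmN BA)|].
by rewrite /scale expr0 subrr mul0r add0r mul1r ltW.
Qed.

Let near_centerS n a : near_center n a -> exists b,
  near_center n.+1 b /\ nrm (b - a) <= 8%:R * (scale n - scale n.+1).
Proof.
move=> [M [/andP[M0 M2] Nx NNx sM]].
have sn0 := scale_gt0 n; have sn1 := scale_le1 n; have x0 := nrm_ge0 BA x.
(* With [s' = scale n.+1] and the tolerance [d = s' * (1 - nrm x)], the new bound [1 + d] meets the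
   invariant, since [(1 - s') * (1 + d) + s' * nrm x = 1 - s' * d]. *)
have d0 : 0 < scale n.+1 * (1 - nrm x) by rewrite mulr_gt0 ?subr_gt0.
have [|b [bx bNx ab]] := center_step x a (scale n) M _ _ M0 d0 Nx NNx sM.
  by rewrite sn0.
have d1 : scale n.+1 * (1 - nrm x) <= 1.
  apply: mulr_ile1; rewrite ?scale_le1 ?(ltW (scale_gt0 _))//; move: x1 x0; lra.
exists b; split.
  exists (1 + scale n.+1 * (1 - nrm x)); split=> //; first by lra.
  by have := scale_gt0 n.+1; nra.
apply: le_trans ab _.
(* [M] and [1 + d] are at most 2, and [4 * scale n] equals [8 * (scale n - scale n.+1)], a form that
   telescopes. *)
apply: (@le_trans _ _ (scale n * (2%:R * 2%:R))); last by rewrite scaleS; lra.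
rewrite -mulrA ler_pM2l//; apply: ler_pM => //; move: M0 d0 d1; lra.
Qed.

Lemma exists_center : is_complete nrm ->
  exists c, N (x - c) 1 <= 1 /\ N (- x - c) 1 <= 1.
Proof.
move=> complete.
(* The default 0 off the invariant makes the step a total function, which [u] iterates. *)
have /choice[g gP] (p : nat * A) : exists b, near_center p.1 p.2 ->
    near_center p.1.+1 b /\ nrm (b - p.2) <= 8%:R * (scale p.1 - scale p.1.+1).
  have [h|h] := pselect (near_center p.1 p.2); last by exists 0 => /h.
  by have [b] := near_centerS _ _ h; exists b.
pose u := fix u n := if n is m.+1 then g (m, u m) else 0.
have uP n : near_center n (u n).
  by elim: n => [|n /(gP (n, u n))[]].
have uD n (k : nat) : nrm (u (n + k)%N - u n) <= 8%:R * (scale n - scale (n + k)%N).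
  elim: k => [|k IH]; first by rewrite addn0 !subrr (nrm0 BA) mulr0.
  have [_ /= h] := gP (_, u (n + k)%N) (uP (n + k)%N).
  rewrite addnS -[u _](subrK (u (n + k)%N)) -addrA.
  apply: le_trans (nrmD BA _ _) _; rewrite /=; lra.
have uN n (k : nat) : (n <= k)%N -> nrm (u k - u n) <= 8%:R * scale n.
  move=> nk; have := uD n (k - n)%N; rewrite subnKC// => /le_trans; apply.
  by have := scale_gt0 k; lra.
have [|c uc] := complete u.
  (* All terms from [n] on are within [8 * scale n < d / 2] of [u n]. *)
  move=> d d0; have [|n nd] := scale_small (d / 16%:R); first by rewrite divr_gt0.
  exists n => i j ni nj; rewrite -[u i](subrK (u n)) -addrA.
  apply: le_lt_trans (nrmD BA _ _) _; rewrite -[u n - u j]opprB (nrmN BA).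
  have := uN _ _ ni; have := uN _ _ nj; lra.
have lim y : (forall n, exists M, [/\ M <= 2%:R, N (y - u n) 1 <= M &
    (1 - scale n) * M + scale n * nrm x <= 1]) -> N (y - c) 1 <= 1.
  move=> yu; apply/ler_addgt0Pr => d d0.
  (* At the index [k = maxn n m] the invariant gives [M <= 1 + 2 * scale k], which is below
     [1 + d / 2]; the distance from [u k] to [c] costs the other [d / 2]. *)
  have [|n nd] := scale_small (d / 4%:R); first by rewrite divr_gt0.
  have [|m mP] := uc (d / 2%:R); first by rewrite divr_gt0.
  have [M [M2 yM sM]] := yu (maxn n m).
  have ud := mP _ (leq_maxr n m).
  have sd : scale (maxn n m) <= scale n.
    by apply: ler_wiXn2l; rewrite ?leq_maxl ?invr_ge0// invf_le1// ler1n.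
  have := norm1D BA (y - u (maxn n m)) (u (maxn n m) - c) 1 0.
  rewrite addrA subrK addr0 (norm1_nrm BA _ AU).
  have := mulr_ge0 (ltW (scale_gt0 (maxn n m))) (nrm_ge0 BA x).
  have : scale (maxn n m) * M <= scale (maxn n m) * 2%:R by rewrite ler_pM2l.
  move: nd sd ud yM sM; lra.
by exists c; split; apply: (lim) => n; have [M [/andP[_ M2] h1 h2 h3]] := uP n;
  exists M.
Qed.

End Iteration.

End Projection.

(** A state sends [1 - 2 a] to a number of modulus at most 1, whose real part is
    [1 - 2 Re (f a 0)]. *)
Lemma halfFA_rA a : in_halfFA mul nrm a -> in_rA mul nrm a.
Proof.
move=> aF f [fd f1 fu].
have := le_dnorm BA fd aF; rewrite f1 (lin1_split _ _ fd.1) fu.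
rewrite (lin1N0 _ fd.1) (lin1Z0 _ _ fd.1) => /(le_trans (Re_le_cabs _)).
by rewrite -complexRe ler0c; case: (f a 0) => p q /=; lra.
Qed.

(* By convexity of [halfFA], which contains 0. *)
Lemma half_center x c t : 0 <= t <= 1 -> N (- x - c) 1 <= 1 ->
  let a := (t / 2%:R)%:C *: (x + c) in in_halfFA mul nrm a /\ nrm a <= t.
Proof.
move=> /andP[t0 t1] xc a.
have E2 : 2%:R *: a = t%:C *: (x + c).
  rewrite scalerA; congr (_ *: _).
  by rewrite -(rmorph_nat (real_complex R)) -rmorphM/= mulrC divfK// pnatr_eq0.
have N1 := norm1_scale1 BA.
split.
  rewrite /in_halfFA /in_FA E2.
  have := norm1D BA (t%:C *: (- x - c)) ((1 - t)%:C *: 0) (t%:C * 1) ((1 - t)%:C * 1).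
  rewrite !norm1Z// !cabs_real !ger0_norm ?subr_ge0// scaler0 addr0.
  have -> : t%:C * 1 + (1 - t)%:C * 1 = 1.
    by rewrite -mulrDl -rmorphD/= addrC subrK mul1r.
  have ht := ler_wpM2l t0 xc.
  have hu : (1 - t) * N 0 1 <= (1 - t) * 1 by rewrite ler_wpM2l ?subr_ge0.
  rewrite (_ : t%:C *: (- x - c) = - (t%:C *: (x + c))); last first.
    by rewrite -opprD scalerN.
  by move: ht hu; lra.
(* Here [2 a = t ((x + c) - 1) + t 1], and both terms have norm at most [t]. *)
have : cabs 2%:R%:C * nrm a <= t + t.
  rewrite -(nrmZ BA) rmorph_nat E2 -(norm1_nrm BA _ AU).
  have := norm1D BA (t%:C *: - (- x - c)) (t%:C *: 0) (t%:C * - 1) (t%:C * 1).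
  have : N (- (- x - c)) (- 1) <= 1.
    by rewrite -scaleN1r -[- 1 in X in N _ X]mulr1 norm1Z// cabsN cabs1 mul1r.
  rewrite !norm1Z// !cabs_real ger0_norm//.
  rewrite scaler0 addr0 -mulrDr addNr mulr0 opprD !opprK => h /le_trans; apply.
  by apply: lerD; rewrite -[leRHS]mulr1; apply: ler_wpM2l.
by rewrite cabs_real normr_nat; lra.
Qed.

End MIdeal.

(** * The decomposition *)

Theorem theorem6p1 (R : realType) (A : lmodType R[i])
    (mul : A -> A -> A) (nrm : A -> R) :
  BanachAlgebra mul nrm ->
  M_approx_unital mul nrm ->
  forall x : A, nrm x < 1 ->
    (exists a b : A,
        [/\ x = a - b, in_rA mul nrm a, in_rA mul nrm b, nrm a < 1 & nrm b < 1])
    /\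
    (exists a b : A,
        [/\ x = a - b, in_rA mul nrm a, in_rA mul nrm b, nrm a < 1 & nrm b < 1]
        /\ in_halfFA mul nrm a /\ in_halfFA mul nrm b).
Proof.
move=> BA [AU [P [P_App P_lin P_id P_max]]] x x1.
suff [a [b [ab [aF bF]]]] : exists a b : A,
    [/\ x = a - b, in_rA mul nrm a, in_rA mul nrm b, nrm a < 1 & nrm b < 1]
    /\ in_halfFA mul nrm a /\ in_halfFA mul nrm b.
  by split; exists a, b.
have x0 := nrm_ge0 BA x.
(* For [t] strictly between [nrm x] and 1, [x / t] still has norm less than 1, and the bound [t]
   given by [half_center] makes the norms of both summands strictly less than 1. *)
pose t := (1 + nrm x) / 2%:R.
have [t0 t1 xt] : [/\ 0 < t, t < 1 & nrm x < t] by rewrite /t; split; lra.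
pose y := t^-1%:C *: x.
have y1 : nrm y < 1.
  rewrite (nrmZ BA) cabs_real gtr0_norm ?invr_gt0//.
  by rewrite mulrC ltr_pdivrMr// mul1r.
have complete : is_complete nrm by case: BA.
have [c [yc Nyc]] := exists_center BA AU P P_App P_lin P_id P_max y y1 complete.
have t01 : 0 <= t <= 1 by rewrite !ltW.
have [aF a1] := half_center BA AU y c t t01 Nyc.
have [|bF b1] := half_center BA AU (- y) c t t01 _; first by rewrite opprK.
exists ((t / 2%:R)%:C *: (y + c)), ((t / 2%:R)%:C *: (- y + c)).
split=> //; split; last 2 first.
- exact: le_lt_trans a1 t1.
- exact: le_lt_trans b1 t1.
- rewrite -scalerBr opprD opprK addrACA subrr addr0 -mulr2n -scaler_nat scalerA.
  rewrite -(rmorph_nat (real_complex R)) -rmorphM/= divfK ?pnatr_eq0//.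
  by rewrite /y scalerA -rmorphM/= divff ?gt_eqF// scale1r.
- exact: halfFA_rA.
- exact: halfFA_rA.
Qed.
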